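(* For every finite simple digraph $H$ there exists a constant $c_H$ (depending only on $H$) such that for every positive integer $k$ and every tournament $T$, at least one of the following holds: (i) $T$ contains $k$ pairwise vertex-disjoint topological minor copies of $H$; or (ii) there exists a set of at most $c_H\cdot k\log k$ vertices of $T$ (for $k=1$ this bound is read as $\mathcal{O}_H(1)$, i.e. the bounding function is $f(k)\in\mathcal{O}_H(k\log k)$) that intersects every topological minor copy of $H$ in $T$. In other words, $H$ has the Erdős–Pósa property for topological minors in tournaments with a bounding function $f(k)\in\mathcal{O}_H(k\log k)$.
   Context: All digraphs are finite and simple. A tournament is a simple digraph in which every pair of distinct vertices is joined by exactly one arc. A digraph $\widehat H$ is a topological minor copy (model) of a digraph $H$ if there is a map $\phi$ sending vertices of $H$ to pairwise distinct vertices of $\widehat H$ and each arc $(u,v)$ of $H$ to a directed path in $\widehat H$ from $\phi(u)$ to $\phi(v)$, such that these paths are internally vertex-disjoint, contain no vertex $\phi(w)$, $w\in V(H)$, as an internal vertex, and every arc of $\widehat H$ and every vertex of $\widehat H$ not of the form $\phi(w)$ lies on exactly one of these paths. A topological minor copy of $H$ in $T$ is a subgraph of $T$ that is a topological minor copy of $H$. Logarithms are base 2. *)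

(* Defs.v *)
From mathcomp Require Import all_boot.
Set Implicit Arguments. Unset Strict Implicit. Unset Printing Implicit Defensive.

Definition simple_digraph (V : finType) (E : rel V) : Prop := irreflexive E.

Definition tournament (V : finType) (T : rel V) : Prop :=
  irreflexive T /\ forall x y : V, x != y -> (T x y (+) T y x) = true.

(* X : {set V} is the vertex set of a topological minor copy (model) of the
   digraph H in T: there is an injective branch map phi : VH -> V and, for each
   arc (u,v) of H, a directed path in T from phi u to phi v whose sequence of
   internal vertices is P u v; the paths have pairwise disjoint interiors,
   contain no branch vertex as internal vertex, and the copy is the union of
   the branch vertices and these paths. *)
Definition tm_copy (VH : finType) (H : rel VH) (V : finType) (T : rel V)
    (X : {set V}) : Prop :=
  exists (phi : VH -> V) (P : VH -> VH -> seq V),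
    [/\ injective phi,
        (forall u v, H u v ->
           [/\ path T (phi u) (rcons (P u v) (phi v)),
               uniq (P u v) &
               forall x, x \in P u v -> x \notin codom phi]),
        (forall u v u' v', H u v -> H u' v' -> (u, v) != (u', v') ->
           forall x, x \in P u v -> x \notin P u' v') &
        X = [set phi w | w : VH] :|:
            [set x | [exists u, exists v, H u v && (x \in P u v)]]].

(* The bounding function c * k * (1 + floor(log2 k)), which is
   Theta(k log k) for k >= 2 and equals c for k = 1. *)
Definition ep_bound (c k : nat) : nat := c * k * (trunc_log 2 k).+1.

(* Main.v *)
Require Import Defs.
From mathcomp Require Import all_boot.
From mathcomp Require Import zify.
From Stdlib Require Import Classical.
Set Implicit Arguments. Unset Strict Implicit. Unset Printing Implicit Defensive.

(** Call a vertex set s-linked if any two of its vertices remain joined by a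
    walk of bounded length after deleting any s other vertices. A large set that
    is O(k)-linked yields k disjoint copies of H greedily. Both more than
    11s + 4 vertices with out-degrees in a window of length s, and a long
    matching of arcs directed backward across a cut of the ordering by
    decreasing out-degree, yield such a set. Hence, if k disjoint copies do not
    exist, every cut of the degree ordering becomes one-way after deleting O(k)
    vertices.

    If H is strongly connected, no copy crosses a one-way cut, and cutting where
    the packing number is halved gives f(m) <= O(m) + f(a) + f(b) with
    a, b <= m / 2 and a + b <= m, which is O(m log m). Otherwise the vertices of
    H split as W and its complement with no arc back into W. Cut where the
    prefix first packs Theta(k) copies of H[W]; the suffix then packs fewer than
    k copies of the rest, so by induction on the order of H both parts are hit
    by O(k log k) vertices, and so is, for each splitting of H, every copy that
    crosses the cut along it. *)

(** * Out-degrees and linked sets in tournaments *)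

Definition outdeg (V : finType) (T : rel V) (Y : {set V}) (x : V) : nat :=
  #|[set z in Y | T x z]|.

(** Counting the arcs inside [W] gives average out-degree [(#|W| - 1) / 2], which cannot exceed
    [r]. *)
Lemma card_low_outdeg (V : finType) (T : rel V) (W : {set V}) r :
  tournament T -> (forall x, x \in W -> outdeg T W x <= r) -> #|W| <= r.*2.+1.
Proof.
move=> [irr tot] le_r.
have degE x : outdeg T W x = \sum_(z in W) T x z.
  rewrite /outdeg -sum1_card big_mkcond /= [RHS]big_mkcond /=.
  by apply: eq_bigr => z _; rewrite inE; case: (z \in W) => //=; case: (T x z).
have le_sum : \sum_(x in W) outdeg T W x <= #|W| * r.
  by rewrite -sum_nat_const; apply: leq_sum.
have dbl : (\sum_(x in W) outdeg T W x).*2 = #|W| * #|W|.-1.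
  rewrite -addnn {1}(eq_bigr _ (fun x _ => degE x)) exchange_big /=.
  rewrite (eq_bigr _ (fun x _ => degE x)) -big_split /= -sum_nat_const.
  apply: eq_bigr => x xW; rewrite -big_split /= (cardD1 x) xW /= -sum1_card.
  rewrite (bigD1 x) //= irr add0n [LHS]big_mkcond [RHS]big_mkcond /=.
  apply: eq_bigr => z _; rewrite !inE andbC.
  have [//|/tot] := eqVneq z x; case: (z \in W) => //=.
  by case: (T z x); case: (T x z).
case: #|W| le_sum dbl => // n; nia.
Qed.

Section Linkage.
Variables (V : finType) (T : rel V).
Hypothesis tourT : tournament T.

Lemma tournament_total x y : x != y -> ~~ T x y -> T y x.
Proof. by case: tourT => _ tot /tot; case: (T x y). Qed.

Lemma tournament_neq x y : T x y -> x != y.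
Proof. by case: tourT => irr _; apply: contraTneq => ->; rewrite irr. Qed.

Lemma tournament_asym x y : T x y -> ~~ T y x.
Proof.
move=> Txy; case: tourT => _ /(_ _ _ (tournament_neq Txy)).
by rewrite Txy; case: (T y x).
Qed.

Lemma tournament_converse : tournament (fun x y => T y x).
Proof.
case: tourT => irr tot; split=> [x|x y nxy]; first exact: irr.
by rewrite addbC tot.
Qed.

(** [p] lists the vertices after [x], so the walk has at most three internal vertices. *)
Definition linked (s : nat) (Y X : {set V}) : Prop :=
  X \subset Y /\
  forall x y (Z : {set V}), x \in X -> y \in X -> x != y ->
    x \notin Z -> y \notin Z -> #|Z| <= s ->
    exists p, [/\ path T x p, last x p = y, {subset p <= Y :\: Z} & size p <= 4].

(* If [Z] separates [v] from [w], then up to O(s) vertices [Y] splits into the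
   out-neighbours [A] of [v] and the in-neighbours [B] of [w], with all arcs from
   [B] to [A]; the window then bounds out-degrees in [B] and in-degrees in [A]. *)
Lemma degree_window_linked s d (Y X : {set V}) :
  X \subset Y -> (forall x, x \in X -> d <= outdeg T Y x <= d + s) ->
  11 * s + 4 < #|X| -> linked s Y X.
Proof.
move=> sXY win bigX; split=> // v w Z vX wX nvw nvZ nwZ leZ.
apply: NNPP => noP.
have vY := subsetP sXY _ vX; have wY := subsetP sXY _ wX.
have nTvw : ~~ T v w.
  apply/negP=> Tvw; apply: noP; exists [:: w]; split=> //=; first by rewrite Tvw.
  by move=> x; rewrite !inE => /eqP->; rewrite nwZ.
have Twv := tournament_total nvw nTvw.
pose A := [set z in Y :\: Z | T v z].
pose B := [set z in Y :\: Z | T z w].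
pose C := [set z in Y :\: Z | (z != v) && (z != w) && ~~ T v z && ~~ T z w].
have nAB z : z \in A -> z \notin B.
  rewrite !inE => /andP[/andP[zZ zY] Tvz]; apply/negP => /andP[_ Tzw].
  apply: noP; exists [:: z; w]; split=> //=; first by rewrite Tvz Tzw.
  by move=> x; rewrite !inE => /orP[]/eqP->; rewrite ?zZ ?nwZ.
have TBA a b : a \in A -> b \in B -> T b a.
  move=> aA bB; have nab : a != b by apply: contraTneq bB => <-; exact: nAB.
  apply: tournament_total => //; apply/negP => Tab; apply: noP.
  move: aA bB; rewrite !inE => /andP[/andP[aZ aY] Tva] /andP[/andP[bZ bY] Tbw].
  exists [:: a; b; w]; split=> //=; first by rewrite Tva Tab Tbw.
  by move=> x; rewrite !inE => /or3P[]/eqP->; rewrite ?aZ ?bZ ?nwZ.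
have TwA a : a \in A -> T w a.
  move=> aA; apply: tournament_total.
    by apply: contraTneq aA => ->; rewrite inE (negPf nTvw) andbF.
  by move: (aA) (nAB _ aA); rewrite !inE => /andP[-> _].
have dv : outdeg T Y v <= #|A| + s.
  apply: leq_trans (leq_add (leqnn _) leZ); apply: leq_trans (leq_card_setU _ _).
  apply/subset_leq_card/subsetP => z; rewrite !inE => /andP[-> ->].
  by case: (z \in Z).
(* Neither [A] nor [C] contains an in-neighbour of [w], so [w] beats both. *)
have dw : #|A| + #|C| <= outdeg T Y w.
  have dAC : [disjoint A & C].
    apply/pred0P => z /=; rewrite !inE; case: (T v z) => //=.
      by rewrite !andbF.
    by rewrite !andbF.
  rewrite -cardsUI (disjoint_setI0 dAC) cards0 addn0.
  apply/subset_leq_card/subsetP => z; rewrite in_setU => /orP[zA|zC].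
    by rewrite inE TwA // andbT; move: zA; rewrite !inE => /andP[/andP[_ ->]].
  move: zC; rewrite !inE => /andP[/andP[_ ->]] /=.
  by move=> /andP[/andP[/andP[_ zw] _]]; apply: tournament_total.
have wv := win _ vX; have ww := win _ wX.
have leC : #|C| <= 2 * s by move: wv ww dv dw; clear; lia.
(* Each [b] beats all of [A], and [d <= #|A| + s]; the window leaves [b] at most [2 * s] further
   out-neighbours. *)
have leB : #|X :&: B| <= (2 * s).*2.+1.
  apply: (card_low_outdeg tourT) => b; rewrite inE => /andP[bX bB].
  have: #|A| + outdeg T (X :&: B) b <= outdeg T Y b.
    have dAB : [disjoint A & [set z in X :&: B | T b z]].
      apply/pred0P => z /=; rewrite !in_set; apply/negP=> /and3P[zA /andP[_ zB] _].
      move: (nAB z); rewrite !in_set zA => /(_ isT); by rewrite zB.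
    rewrite -cardsUI (disjoint_setI0 dAB) cards0 addn0.
    apply/subset_leq_card/subsetP => z; rewrite in_setU => /orP[zA|].
      by rewrite inE TBA // andbT; move: zA; rewrite !inE => /andP[/andP[_ ->]].
    by rewrite !inE => /andP[/andP[/(subsetP sXY)-> _] ->].
  move: (win _ bX) dv wv; clear; lia.
(* Since [v], [w] and all of [B] beat [a], its out-neighbours outside [A] lie in [Z] or [C]. With
   [#|A| + #|C| <= d + s] and out-degree at least [d], the in-degree of [a] inside [A] is at most
   [2 * s]. *)
have leA : #|X :&: A| <= (2 * s).*2.+1.
  apply: (card_low_outdeg tournament_converse) => a; rewrite inE => /andP[aX aA].
  have split_A : outdeg T A a + outdeg (fun x y => T y x) A a <= #|A|.
    rewrite -cardsUI [X in _ + #|pred_of_set X|](_ : _ = set0) ?cards0 ?addn0.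
      by apply/subset_leq_card/subsetP => z; rewrite in_setU !in_set => /orP[]/andP[].
    apply/setP => z; rewrite !in_set; apply/negP=> /andP[/andP[_ h1] /andP[_ h2]].
    by move: (tournament_asym h1); rewrite h2.
  have : outdeg T Y a <= outdeg T A a + #|Z| + #|C|.
    apply: leq_trans (leq_add (leq_card_setU _ _) (leqnn _)).
    apply: leq_trans (leq_card_setU _ _).
    apply/subset_leq_card/subsetP => z; rewrite inE => /andP[zY Taz].
    have nTza := tournament_asym Taz.
    have nzv : z != v.
      apply: contraNneq nTza => ->; by move: aA; rewrite inE => /andP[].
    have nzw : z != w by apply: contraNneq nTza => ->; exact: TwA.
    have nzB : z \notin B by apply: contraNN nTza => zB; exact: TBA.
    move: nzB; rewrite !inE zY Taz nzv nzw /=.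
    by case: (z \in Z) => //=; rewrite ?orbT //; case: (T v z) => //= ->.
  have : outdeg (fun x y => T y x) (X :&: A) a <= outdeg (fun x y => T y x) A a.
    apply/subset_leq_card/subsetP => z; rewrite !inE.
    by move=> /andP[/andP[_ ->] ->].
  move: (win _ aX) ww dw leZ split_A; clear; lia.
(* The summands are at most [4 * s + 1] (twice), [s], [2 * s] and 2, in total [11 * s + 4]. *)
have : #|X| <= #|X :&: A| + #|X :&: B| + #|Z| + #|C| + #|[set v; w]|.
  apply: leq_trans (leq_add (leq_add (leq_add (leq_card_setU _ _) (leqnn _)) (leqnn _)) (leqnn _)).
  apply: leq_trans (leq_add (leq_add (leq_card_setU _ _) (leqnn _)) (leqnn _)).
  apply: leq_trans (leq_add (leq_card_setU _ _) (leqnn _)).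
  apply: leq_trans (leq_card_setU _ _).
  apply/subset_leq_card/subsetP => z zX; rewrite !inE zX (subsetP sXY _ zX) /=.
  by case: (z \in Z); case: (z == v); case: (z == w); case: (T v z); case: (T z w).
rewrite cards2 nvw; move: leA leB leC leZ bigX; clear; lia.
Qed.

(** * Cuts of the ordering by decreasing out-degree, and arcs going backward across them *)

Definition degree_cut (Y P : {set V}) : Prop :=
  P \subset Y /\
  forall x y, x \in P -> y \in Y :\: P -> outdeg T Y y <= outdeg T Y x.

Definition backward_matching (Y P X : {set V}) (f : V -> V) : Prop :=
  [/\ X \subset P, {in X &, injective f} &
      forall x, x \in X -> f x \in Y :\: P /\ T (f x) x].

Definition no_arcs (A B : {set V}) : Prop :=
  forall x y, x \in A -> y \in B -> ~~ T x y.

(** Greedy matching: if no further backward arc can be added, the endpoints of the matching meet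
    every backward arc. *)
Lemma backward_matching_or_cover (Y P : {set V}) m :
  (exists X f, backward_matching Y P X f /\ #|X| = m) \/
  (exists Z : {set V}, #|Z| <= 2 * m /\ no_arcs ((Y :\: P) :\: Z) (P :\: Z)).
Proof.
elim: m => [|m [[X [f [[sXP injf bf] cX]]]|[Z [leZ noZ]]]].
- by left; exists set0, id; split; [split=> [|x y|x]; rewrite ?sub0set ?inE | rewrite cards0].
- case: (classic (no_arcs ((Y :\: P) :\: (X :|: f @: X)) (P :\: (X :|: f @: X)))) => [no|].
    right; exists (X :|: f @: X); split=> //.
    apply: leq_trans (leq_card_setU _ _) _.
    by rewrite (card_in_imset injf) cX; lia.
  move=> /not_all_ex_not[y /not_all_ex_not[x nyx]].
  have {nyx} [yB [xB Tyx]] : y \in (Y :\: P) :\: (X :|: f @: X) /\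
     x \in P :\: (X :|: f @: X) /\ T y x.
    by split; [|split]; apply: NNPP => h; apply: nyx => h1 h2 //; apply/negP.
  move: yB xB; rewrite in_setD => /andP[nyX yYP].
  rewrite in_setD => /andP[nxX xP].
  have nX : x \notin X by apply: contraNN nxX => h; rewrite inE h.
  have nyf z : z \in X -> y != f z.
    by move=> zX; apply: contraNneq nyX => ->; rewrite inE imset_f ?orbT.
  left; exists (x |: X), (fun z => if z == x then y else f z); split; last first.
    by rewrite cardsU1 nX cX.
  split.
  + by apply/subsetP=> z; rewrite !inE => /orP[/eqP->//|/(subsetP sXP)].
  + move=> a b; rewrite !inE.
    have [->|na] := eqVneq a x; have [->|nb] := eqVneq b x => //= aX bX E.
    * by have := nyf _ bX; rewrite E eqxx.
    * by have := nyf _ aX; rewrite E eqxx.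
    * exact: injf.
  + move=> a; rewrite !inE; have [->|na] /= := eqVneq a x.
      by move: yYP; rewrite in_setD.
    by move=> /bf[]; rewrite in_setD.
right; exists Z; split=> //; lia.
Qed.

(* The walks are [a -> w -> f c -> c -> b]: the degree gap provides many [w], and
   restricting to [b] of large in-degree inside [X] provides many [c]. *)
Lemma backward_matching_linked s (Y P X : {set V}) f :
  degree_cut Y P -> backward_matching Y P X f -> 14 * s + 5 <= #|X| ->
  exists X0 : {set V}, linked s Y X0 /\ s <= #|X0|.
Proof.
move=> [sPY cutP] [sXP injf bf] bigX.
have [x0 x0X] : exists x, x \in X by apply/set0Pn; rewrite -card_gt0; move: bigX; clear; lia.
have [x1 x1P minx1] : exists2 x1, x1 \in P & forall x, x \in P -> outdeg T Y x1 <= outdeg T Y x.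
  have x0P := subsetP sXP _ x0X.
  by exists [arg min_(x < x0 in P) outdeg T Y x]; case: arg_minnP.
set d := outdeg T Y x1 in minx1.
(* [W] fills a degree window, so it is linked if large; otherwise it is discarded, and the rest of
   [P] has out-degree above [d + s]. *)
pose W := [set x in P | outdeg T Y x <= d + s].
case: (leqP #|W| (11 * s + 4)) => [smallW|bigW]; last first.
  exists W; split; last by move: bigW; clear; lia.
  apply: (@degree_window_linked s d) => //.
    by apply/subsetP => x; rewrite inE => /andP[/(subsetP sPY)].
  by move=> x; rewrite inE => /andP[/minx1 -> ->].
pose X1 := X :\: W.
pose L := [set x in X1 | outdeg (fun a b => T b a) X1 x <= s].
have leL : #|L| <= s.*2.+1.
  apply: (card_low_outdeg tournament_converse) => x xL.
  move: (xL); rewrite inE => /andP[_]; apply: leq_trans.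
  apply/subset_leq_card/subsetP => z; rewrite !in_set.
  by move=> /andP[/andP[-> _] ->].
(* Of [14 * s + 5] vertices, at most [11 * s + 4] are lost to [W] and [2 * s + 1] to [L], which
   leaves [s]. *)
exists (X1 :\: L); split; last first.
  have := cardsID W X; have := cardsID L X1.
  have := subset_leq_card (subsetIr X W); have := subset_leq_card (subsetIr X1 L).
  by rewrite -/X1; move: leL smallW bigX; clear; lia.
have sX1P : X1 \subset P by apply: subset_trans (subsetDl _ _) sXP.
split; first by apply: subset_trans (subset_trans sX1P sPY); exact: subsetDl.
move=> a b Z; rewrite [a \in _]in_setD => /andP[_ aX1].
rewrite [b \in _]in_setD => /andP[nbL bX1] nab naZ nbZ leZ.
pose N := [set z in X1 | T z b].
have bigN : s < #|N|.
  by move: nbL; rewrite inE bX1 /= -ltnNge.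
(* [g z] lies in [Z] as soon as [z] or [f z] does, and [g] is injective because [f] leaves [P]. As
   [#|N| > s], some [c] has both [c] and [f c] outside [Z]. *)
pose g z := if z \in Z then z else f z.
have sNX z : z \in N -> z \in X by rewrite !inE => /andP[/andP[_ ->]].
have injg : {in N &, injective g}.
  move=> y z /sNX yX /sNX zX; rewrite /g.
  have fP t : t \in X -> f t \notin P by move=> /bf[]; rewrite inE => /andP[].
  case: ifP => _; case: ifP => _; [by [] | move=> E | move=> E | exact: injf].
    by move: (fP _ zX); rewrite -E (subsetP sXP).
  by move: (fP _ yX); rewrite E (subsetP sXP).
have [c cN gcZ] : exists2 c, c \in N & g c \notin Z.
  have: ~~ (g @: N \subset Z).
    by apply/negP => /subset_leq_card; rewrite (card_in_imset injg); move: bigN leZ; clear; lia.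
  by move=> /subsetPn[_ /imsetP[c cN ->] gc]; exists c.
have [ncZ nfcZ] : c \notin Z /\ f c \notin Z.
  by move: gcZ; rewrite /g; case: ifP => // ->.
have cX := sNX _ cN; have [fcYP Tfc] := bf _ cX.
have Tcb : T c b by move: cN; rewrite inE => /andP[].
have fcY : f c \in Y by move: fcYP; rewrite inE => /andP[].
(* [f c] lies beyond the cut, so its out-degree is at most [d]; hence more than [s] out-neighbours
   of [a] are not out-neighbours of [f c]. *)
have degs : outdeg T Y (f c) + s < outdeg T Y a.
  have := cutP _ _ x1P fcYP; rewrite -/d.
  move: aX1; rewrite !inE => /andP[+ aX]; rewrite (subsetP sXP _ aX) /= -ltnNge.
  by clear; lia.
have [w wa nwZ] : exists2 w, w \in [set z in Y | T a z] :\: [set z in Y | T (f c) z] & w \notin Z.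
  apply/subsetPn; apply/negP => /subset_leq_card.
  have := cardsID [set z in Y | T (f c) z] [set z in Y | T a z].
  have := subset_leq_card (subsetIr [set z in Y | T a z] [set z in Y | T (f c) z]).
  by move: degs leZ; rewrite /outdeg; clear; lia.
move: wa; rewrite !inE => /andP[+ /andP[wY Taw]]; rewrite wY /= => nTw.
have bY : b \in Y by apply/(subsetP sPY)/(subsetP sX1P).
have cY : c \in Y by apply/(subsetP sPY)/(subsetP sXP).
(* Not being an out-neighbour of [f c], [w] may be [f c] itself, which shortens the walk. *)
have [E|nw] := eqVneq w (f c).
  exists [:: f c; c; b]; split=> //=; first by rewrite -{1}E Taw Tfc Tcb.
  by move=> x; rewrite !inE => /or3P[]/eqP->; rewrite ?nfcZ ?ncZ ?nbZ.
exists [:: w; f c; c; b]; split=> //=.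
  by rewrite Taw Tfc Tcb (tournament_total _ nTw) // eq_sym.
by move=> x; rewrite !inE => /or4P[]/eqP->; rewrite ?nwZ ?nfcZ ?ncZ ?nbZ.
Qed.

(** A backward matching of [14 * s + 5] arcs would force a large linked set, so a cover by twice as
    many vertices exists. *)
Lemma degree_cut_cover s (Y P : {set V}) :
  degree_cut Y P ->
  (forall X0 : {set V}, linked s Y X0 -> #|X0| < s) ->
  exists Z : {set V}, #|Z| <= 28 * s + 10 /\ no_arcs ((Y :\: P) :\: Z) (P :\: Z).
Proof.
move=> cutP nolink.
case: (backward_matching_or_cover Y P (14 * s + 5)) => [[X [f [bm cX]]]|[Z [leZ noZ]]].
  have [|X0 [lX0]] := @backward_matching_linked s _ _ _ _ cutP bm; first by rewrite cX.
  by rewrite leqNgt nolink.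
exists Z; split=> //; lia.
Qed.

Lemma degree_cutS (Y P : {set V}) :
  degree_cut Y P -> P != Y -> exists2 v, v \in Y :\: P & degree_cut Y (v |: P).
Proof.
move=> [sPY cutP] nPY.
have [v0 v0YP] : exists v, v \in Y :\: P.
  by apply/set0Pn; rewrite setD_eq0; apply: contraNN nPY => h; rewrite eqEsubset sPY.
pose v := [arg max_(x > v0 in Y :\: P) outdeg T Y x].
have [vYP maxv] : v \in Y :\: P /\ forall x, x \in Y :\: P -> outdeg T Y x <= outdeg T Y v.
  by rewrite /v; case: arg_maxnP.
exists v => //; split.
  apply/subsetP => z; rewrite !inE => /orP[/eqP->|/(subsetP sPY)//].
  by move: vYP; rewrite inE => /andP[].
move=> x y; rewrite !inE => xvP /andP[]; rewrite negb_or => /andP[nyv nyP] yY.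
have yYP : y \in Y :\: P by rewrite inE nyP.
by case/orP: xvP => [/eqP->|xP]; [exact: maxv | exact: cutP].
Qed.

(** The empty cut grows one vertex at a time until [Q] fails. With [Q] denying a packing, this
    places a cut at a prescribed packing number. *)
Lemma maximal_degree_cut (Y : {set V}) (Q : {set V} -> Prop) :
  Q set0 ->
  Q Y \/ exists P v, [/\ v \in Y :\: P, degree_cut Y (v |: P), Q P & ~ Q (v |: P)].
Proof.
have : degree_cut Y set0 by split=> [|x y]; rewrite ?sub0set ?inE.
move: set0 => P; have [n] := ubnP #|Y :\: P|.
elim: n P => // n IH P ltn cutP QP.
have [<-|nPY] := eqVneq P Y; first by left.
have [v vYP cutv] := degree_cutS cutP nPY.
have [Qv|nQv] := classic (Q (v |: P)); last by right; exists P, v.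
apply: IH Qv => //; rewrite ltnS in ltn; apply: leq_trans ltn.
by rewrite (cardsD1 v (Y :\: P)) vYP setUC -setDDl.
Qed.

End Linkage.

(** * Copies inside a vertex set and their packings *)

Lemma disjoint_setUl (V : finType) (A B C : {set V}) :
  [disjoint A :|: B & C] = [disjoint A & C] && [disjoint B & C].
Proof. by rewrite !disjoints_subset subUset. Qed.

Lemma disjoint_setUr (V : finType) (A B C : {set V}) :
  [disjoint A & B :|: C] = [disjoint A & B] && [disjoint A & C].
Proof. by rewrite disjoint_sym disjoint_setUl !(disjoint_sym (mem A)). Qed.

Section Models.
Variables (VH : finType) (H : rel VH) (V : finType) (T : rel V).
Implicit Types (U W : {set VH}) (X Y Z A B : {set V}).

Definition sub_arc U u v := [&& u \in U, v \in U & H u v].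

(* Unlike in [tm_copy], the copy only has to lie inside [X], which makes the
   predicate monotone in [X]. *)
Definition hosts U X : Prop :=
  exists (phi : VH -> V) (P : VH -> VH -> seq V),
    [/\ {in U &, injective phi},
        (forall u, u \in U -> phi u \in X),
        (forall u v, sub_arc U u v ->
           [/\ path T (phi u) (rcons (P u v) (phi v)), uniq (P u v),
               {subset P u v <= X} &
               forall w, w \in U -> phi w \notin P u v]) &
        (forall u v u' v', sub_arc U u v -> sub_arc U u' v' ->
           (u, v) != (u', v') -> forall x, x \in P u v -> x \notin P u' v')].

Lemma hostsS U X Y : X \subset Y -> hosts U X -> hosts U Y.
Proof.
move=> /subsetP sXY [phi [P [inj inX pathP dis]]]; exists phi, P; split=> //.
  by move=> u /inX /sXY.
by move=> u v /pathP[? ? sub ?]; split=> // x /sub /sXY.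
Qed.

Lemma hosts_restrict U W X : W \subset U -> hosts U X -> hosts W X.
Proof.
move=> /subsetP sWU [phi [P [inj inX pathP dis]]]; exists phi, P.
have arcS u v : sub_arc W u v -> sub_arc U u v.
  by move=> /and3P[/sWU uU /sWU vU Huv]; apply/and3P.
split=> [u v /sWU uU /sWU vU|u /sWU /inX //|u v|u v u' v']; first exact: inj.
  by move=> /arcS /pathP[? ? ? nb]; split=> // w /sWU /nb.
by move=> /arcS a /arcS b; exact: dis.
Qed.

Lemma hosts_nonempty U X : U != set0 -> hosts U X -> X != set0.
Proof.
case/set0Pn=> u uU [phi [P [_ inX _ _]]].
by apply/set0Pn; exists (phi u); apply: inX.
Qed.

(** Recursion on [k] instead of an indexed family lets packings be trimmed and merged by
    induction. *)
Fixpoint pack U k Y : Prop :=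
  if k is k'.+1 then
    exists X1 X2, [/\ X1 \subset Y, X2 \subset Y, [disjoint X1 & X2],
                      hosts U X1 & pack U k' X2]
  else True.

Lemma packS U k X Y : X \subset Y -> pack U k X -> pack U k Y.
Proof.
case: k => // k sXY [X1 [X2 [s1 s2 d h p]]]; exists X1, X2.
by split=> //; apply: subset_trans sXY.
Qed.

Lemma pack_leq U k l Y : k <= l -> pack U l Y -> pack U k Y.
Proof.
elim: l k Y => [|l IH] k Y; first by rewrite leqn0 => /eqP->.
rewrite leq_eqVlt => /orP[/eqP->//|]; rewrite ltnS => lekl.
by move=> [X1 [X2 [_ s2 _ _ /(IH _ _ lekl)]]]; apply: packS.
Qed.

Lemma pack1 U Y : hosts U Y -> pack U 1 Y.
Proof. by exists Y, set0; split=> //; rewrite ?sub0set // disjoints_subset setC0 subsetT. Qed.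

Lemma pack_set0 U k : U != set0 -> 0 < k -> ~ pack U k set0.
Proof.
case: k => // k U0 _ [X1 [X2 [+ _ _ /(hosts_nonempty U0)]]].
by rewrite subset0 => /eqP->; rewrite eqxx.
Qed.

Lemma pack_add U a b A B :
  [disjoint A & B] -> pack U a A -> pack U b B -> pack U (a + b) (A :|: B).
Proof.
elim: a A => [|a IH] A dAB; first by move=> _; apply/packS/subsetUr.
move=> [X1 [X2 [s1 s2 d h p]]] pB; exists X1, (X2 :|: B); split=> //.
- by apply: subset_trans s1 _; exact: subsetUl.
- exact: setSU.
- by rewrite disjoint_setUr d; apply: disjointWl dAB.
- by apply: IH => //; apply: disjointWl dAB.
Qed.

(** A vertex lies in at most one of the disjoint hosts, and that one is dropped. *)
Lemma pack_setD1 U k Y z : pack U k.+1 Y -> pack U k (Y :\ z).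
Proof.
elim: k Y => // k IH Y [X1 [X2 [s1 s2 d h p]]].
have [zX1|nzX1] := boolP (z \in X1).
  by apply: (@packS U k.+1 X2) => //; rewrite subsetD1 s2 (disjointFr d zX1).
exists X1, (X2 :\ z); split=> //; first by rewrite subsetD1 s1.
- exact: setSD.
- by apply: disjointWr d; exact: subsetDl.
- exact: IH.
Qed.

Lemma pack_setD U k n Y Z : #|Z| <= n -> pack U (k + n) Y -> pack U k (Y :\: Z).
Proof.
elim: n Y Z => [|n IH] Y Z; first by rewrite leqn0 cards_eq0 addn0 => /eqP->; rewrite setD0.
have [->|/set0Pn[z zZ]] := eqVneq Z set0.
  by move=> _; rewrite setD0; apply: pack_leq; exact: leq_addr.
rewrite (cardsD1 z) zZ addnS ltnS => leZ /pack_setD1 - /(_ z) /(IH _ _ leZ).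
by rewrite setDDl setD1K.
Qed.

(** * Splitting and joining copies across a one-way cut *)

Definition down_closed U W : Prop :=
  W \subset U /\ forall u v, u \in U :\: W -> v \in W -> ~~ H u v.

Lemma no_arcs_path_stays A B x p :
  no_arcs T B A -> path T x p -> {subset p <= A :|: B} -> x \in B ->
  {subset p <= B}.
Proof.
move=> noBA; elim: p x => // y p IH x /= /andP[Txy pathp] sub xB z.
have yB : y \in B.
  have /setUP[yA|//] := sub _ (mem_head _ _).
  by have := noBA _ _ xB yA; rewrite Txy.
rewrite inE => /orP[/eqP->//|]; apply: IH yB _ => // t tp.
by apply: sub; rewrite inE tp orbT.
Qed.

(** [W] collects the vertices of [U] with branch vertex in [A]. A path that reaches [B] stays there,
    so no arc of [H] leads back into [W]. *)
Lemma hosts_split U A B :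
  no_arcs T B A -> [disjoint A & B] -> hosts U (A :|: B) ->
  exists W, [/\ down_closed U W, hosts W A & hosts (U :\: W) B].
Proof.
move=> noBA dAB [phi [P [inj inX pathP dis]]].
pose W := [set u in U | phi u \in A].
have notB u : u \in U :\: W -> phi u \in B.
  rewrite !inE => /andP[+ uU]; rewrite uU /= => nA.
  by have := inX _ uU; rewrite inE (negPf nA).
have stay u v : sub_arc U u v -> phi u \in B -> phi v \in B /\ {subset P u v <= B}.
  move=> arcuv uB; have [pth _ sub _] := pathP _ _ arcuv.
  have /and3P[_ vU _] := arcuv.
  have all : {subset rcons (P u v) (phi v) <= B}.
    apply: (no_arcs_path_stays noBA pth) uB => x.
    by rewrite mem_rcons inE => /orP[/eqP->|/sub//]; exact: inX.
  by split=> [|x xP]; apply: all; rewrite mem_rcons inE ?eqxx ?xP ?orbT.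
have arcW u v : sub_arc W u v -> sub_arc U u v.
  by rewrite /sub_arc !inE => /and3P[/andP[-> _] /andP[-> _] ->].
have arcD u v : sub_arc (U :\: W) u v -> sub_arc U u v.
  by rewrite /sub_arc !inE => /and3P[/andP[_ ->] /andP[_ ->] ->].
exists W; split.
- split; first by apply/subsetP => u; rewrite inE => /andP[].
  move=> u v uD vW; apply/negP => Huv.
  have arcuv : sub_arc U u v.
    by move: uD vW; rewrite /sub_arc !inE Huv => /andP[_ ->] /andP[->].
  have [vB _] := stay _ _ arcuv (notB _ uD).
  by move: vW; rewrite inE => /andP[_ vA]; rewrite (disjointFr dAB vA) in vB.
- exists phi, P; split.
  + by move=> u v; rewrite !inE => /andP[uU _] /andP[vU _]; exact: inj.
  + by move=> u; rewrite inE => /andP[].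
  + move=> u v arcuv; have [pth un sub nb] := pathP _ _ (arcW _ _ arcuv).
    split=> //; last by move=> w; rewrite inE => /andP[/nb].
    (* An internal vertex in [B] would trap the rest of the path in [B], including its end [phi v],
       which lies in [A]. *)
    move=> x xP; have /setUP[//|xB] := sub _ xP.
    have vA : phi v \in A by have /and3P[_ + _] := arcuv; rewrite inE => /andP[].
    have vU : v \in U by have /and3P[_ + _] := arcuv; rewrite inE => /andP[].
    case/splitPr: xP pth sub {un nb} => p1 p2; rewrite rcons_cat cat_path /=.
    move=> /and3P[_ _ pth] sub.
    have : phi v \in B.
      apply: (no_arcs_path_stays noBA pth) xB _ _ => [t|]; rewrite mem_rcons inE.
        case/orP=> [/eqP->|tp]; first exact: inX.
        by apply: sub; rewrite mem_cat inE tp !orbT.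
      by rewrite eqxx.
    by rewrite (disjointFr dAB vA).
  + by move=> u v u' v' /arcW a /arcW b; exact: dis.
- exists phi, P; split.
  + by move=> u v; rewrite !inE => /andP[_ uU] /andP[_ vU]; exact: inj.
  + exact: notB.
  + move=> u v arcuv; have [pth un _ nb] := pathP _ _ (arcD _ _ arcuv).
    have /and3P[uD _ _] := arcuv.
    have [_ sub] := stay _ _ (arcD _ _ arcuv) (notB _ uD).
    by split=> // w; rewrite inE => /andP[_ /nb].
  + by move=> u v u' v' /arcD a /arcD b; exact: dis.
Qed.

(** All arcs between [A] and [B] go forward, so each arc of [H] from [W] to [U :\: W] is realised by
    a single arc with empty interior. *)
Lemma hosts_join U W A B :
  down_closed U W -> [disjoint A & B] ->
  (forall x y, x \in A -> y \in B -> T x y) ->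
  hosts W A -> hosts (U :\: W) B -> hosts U (A :|: B).
Proof.
move=> [/subsetP sWU clos] dAB TAB [phi1 [P1 [inj1 in1 path1 dis1]]].
move=> [phi2 [P2 [inj2 in2 path2 dis2]]].
pose phi u := if u \in W then phi1 u else phi2 u.
pose P u v := if u \in W then (if v \in W then P1 u v else [::]) else P2 u v.
have inD u : u \in U -> u \notin W -> u \in U :\: W by rewrite inE => -> ->.
have nAB x y : x \in A -> y \in B -> x != y.
  by move=> xA yB; apply: contraTneq yB => <-; rewrite (disjointFr dAB xA).
have arcE u v : sub_arc U u v ->
  [\/ [/\ u \in W, v \in W & sub_arc W u v],
      [/\ u \in W, v \notin W & v \in U :\: W] |
      [/\ u \notin W, v \notin W & sub_arc (U :\: W) u v]].
  move=> /and3P[uU vU Huv].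
  have [uW|nuW] := boolP (u \in W); have [vW|nvW] := boolP (v \in W).
  - by constructor 1; rewrite /sub_arc uW vW.
  - by constructor 2; rewrite inD.
  - by have := clos _ _ (inD _ uU nuW) vW; rewrite Huv.
  - by constructor 3; rewrite /sub_arc !inD.
have PE u v x : sub_arc U u v -> x \in P u v ->
    (x \in P1 u v /\ sub_arc W u v /\ x \in A) \/
    (x \in P2 u v /\ sub_arc (U :\: W) u v /\ x \in B).
  move=> /arcE[[uW vW a]|[uW nvW _]|[nuW nvW a]].
  - by rewrite /P uW vW => xP; left; have [_ _ /(_ x xP) xA _] := path1 _ _ a.
  - by rewrite /P uW (negPf nvW).
  - by rewrite /P (negPf nuW) => xP; right; have [_ _ /(_ x xP) xB _] := path2 _ _ a.
exists phi, P; split.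
- move=> u v uU vU; rewrite /phi.
  case: ifPn => uW; case: ifPn => vW; first exact: inj1.
  + by move=> E; have := nAB _ _ (in1 _ uW) (in2 _ (inD _ vU vW)); rewrite E eqxx.
  + by move=> E; have := nAB _ _ (in1 _ vW) (in2 _ (inD _ uU uW)); rewrite E eqxx.
  + by apply: inj2; exact: inD.
- move=> u uU; rewrite /phi inE; case: ifPn => uW; first by rewrite in1.
  by rewrite in2 ?orbT //; exact: inD.
- move=> u v arcuv; split.
  + case: (arcE _ _ arcuv) => [[uW vW a]|[uW nvW vD]|[nuW nvW a]].
    * by rewrite /phi /P uW vW; have [] := path1 _ _ a.
    * rewrite /phi /P uW (negPf nvW) /= andbT; apply: TAB; [exact: in1|exact: in2].
    * by rewrite /phi /P (negPf nuW) (negPf nvW); have [] := path2 _ _ a.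
  + case: (arcE _ _ arcuv) => [[uW vW a]|[uW nvW vD]|[nuW nvW a]].
    * by rewrite /P uW vW; have [] := path1 _ _ a.
    * by rewrite /P uW (negPf nvW).
    * by rewrite /P (negPf nuW); have [] := path2 _ _ a.
  + by move=> x /(PE _ _ _ arcuv)[[_ [_ xA]]|[_ [_ xB]]]; rewrite inE ?xA ?xB ?orbT.
  + move=> w wU; apply/negP => /(PE _ _ _ arcuv); rewrite /phi.
    case: ifPn => wW [[xP [a xX]]|[xP [a xX]]].
    * by have [_ _ _ /(_ w wW)] := path1 _ _ a; rewrite xP.
    * by have := nAB _ _ (in1 _ wW) xX; rewrite eqxx.
    * by have := nAB _ _ xX (in2 _ (inD _ wU wW)); rewrite eqxx.
    * by have [_ _ _ /(_ w (inD _ wU wW))] := path2 _ _ a; rewrite xP.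
- move=> u v u' v' a a' neq x /(PE _ _ _ a) h; apply/negP => /(PE _ _ _ a') h'.
  case: h h' => [[xP [b xX]]|[xP [b xX]]] [[xP' [b' xX']]|[xP' [b' xX']]].
  + by have := dis1 _ _ _ _ b b' neq _ xP; rewrite xP'.
  + by have := nAB _ _ xX xX'; rewrite eqxx.
  + by have := nAB _ _ xX' xX; rewrite eqxx.
  + by have := dis2 _ _ _ _ b b' neq _ xP; rewrite xP'.
Qed.

Lemma pack_join U W k A B :
  down_closed U W -> [disjoint A & B] ->
  (forall x y, x \in A -> y \in B -> T x y) ->
  pack W k A -> pack (U :\: W) k B -> pack U k (A :|: B).
Proof.
move=> clos; elim: k A B => // k IH A B dAB TAB.
move=> [A1 [A2 [sA1 sA2 dA hA pA]]] [B1 [B2 [sB1 sB2 dB hB pB]]].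
have dis X Y : X \subset A -> Y \subset B -> [disjoint X & Y].
  by move=> sX sY; apply: disjointWl sX _; apply: disjointWr sY _.
have arcs X Y : X \subset A -> Y \subset B -> forall x y, x \in X -> y \in Y -> T x y.
  by move=> /subsetP sX /subsetP sY x y /sX xA /sY yB; exact: TAB.
exists (A1 :|: B1), (A2 :|: B2); split; try exact: setUSS.
- rewrite disjoint_setUl !disjoint_setUr dA dB andbT /=.
  by rewrite dis // disjoint_sym dis.
- by apply: (hosts_join clos) => //; [exact: dis | exact: arcs].
- by apply: IH => //; [exact: dis | exact: arcs].
Qed.

(** * Greedy embedding of copies into linked sets *)

Lemma walk_shorten x y p :
  path T x p -> last x p = y -> x != y ->
  exists q, [/\ path T x (rcons q y), uniq (x :: rcons q y),
                {subset q <= p} & size q < size p].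
Proof.
case/shortenP=> p' pathp' un sub; case/lastP: p' pathp' un sub => [|q z].
  by move=> _ _ _ /= ->; rewrite eqxx.
rewrite last_rcons => pathq un sub Ez nxy; rewrite Ez in pathq un sub.
exists q; split=> // [t tq|]; first by apply: sub; rewrite mem_rcons inE tq orbT.
move: un => /= /andP[_ un]; have := uniq_leq_size un sub.
by rewrite size_rcons.
Qed.

(** Branch vertices, plus three internal vertices for every ordered pair, whether or not it is an
    arc. *)
Definition copy_size : nat := #|VH| + 3 * (#|VH| * #|VH|).

(** Arcs are routed one after another, and [Z] accumulates the interiors used so far. *)
Lemma linked_arc_paths s Y X (phi : VH -> V) (l : seq (VH * VH)) :
  irreflexive H -> linked T s Y X -> injective phi -> (forall u, phi u \in X) ->
  uniq l -> 3 * size l + #|VH| <= s ->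
  exists (P : VH * VH -> seq V) Z,
    [/\ #|Z| <= 3 * size l, Z \subset Y, (forall w, phi w \notin Z),
        (forall a, a \in l -> H a.1 a.2 ->
          [/\ path T (phi a.1) (rcons (P a) (phi a.2)), uniq (P a) &
              {subset P a <= Z}]) &
        (forall a b, a \in l -> b \in l -> H a.1 a.2 -> H b.1 b.2 -> a != b ->
          forall x, x \in P a -> x \notin P b)].
Proof.
move=> irrH [sXY link] inj inX; elim: l => [|a l IH].
  by exists (fun _ => [::]), set0; split; rewrite ?cards0 ?sub0set // => w; rewrite inE.
rewrite cons_uniq [size (a :: l)]/= => /andP[nal unl] les.
have [|P [Z [leZ sZY nphi pathP dis]]] := IH unl; first by move: les; clear; lia.
case: (boolP (H a.1 a.2)) => [Ha|nHa]; last first.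
  exists P, Z; split=> //; first by move: leZ; clear; lia.
    by move=> b; rewrite inE => /orP[/eqP-> Hb|/pathP//]; rewrite Hb in nHa.
  move=> b c; rewrite !inE => /orP[/eqP->|bl] /orP[/eqP->|cl]; rewrite ?(negPf nHa) //.
  exact: dis.
have na : phi a.1 != phi a.2.
  by apply: contraTneq Ha => /inj ->; rewrite irrH.
(* The new path must avoid the earlier interiors and all branch vertices other than its own ends. *)
pose Z' := Z :|: ([set phi w | w : VH] :\: [set phi a.1; phi a.2]).
have leZ' : #|Z'| <= s.
  apply: leq_trans (leq_card_setU _ _) _.
  have cphi : #|[set phi w | w : VH]| = #|VH| by rewrite (card_imset _ inj).
  have := subset_leq_card (subsetDl [set phi w | w : VH] [set phi a.1; phi a.2]).
  rewrite cphi; move: leZ les; clear; lia.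
have nZ' b : b \in [set phi a.1; phi a.2] -> b \notin Z'.
  move=> hb; rewrite !inE negb_or; move: (hb); rewrite !inE => ->; rewrite andbT.
  by move: hb; rewrite !inE => /orP[]/eqP->.
have [||p [pathp lastp subp sizep]] := link _ _ _ (inX a.1) (inX a.2) na _ _ leZ'.
- by apply: nZ'; rewrite !inE eqxx.
- by apply: nZ'; rewrite !inE eqxx orbT.
have [q [pathq unq subq sizeq]] := walk_shorten pathp lastp na.
have qZ' x : x \in q -> x \in Y /\ x \notin Z'.
  by move=> /subq /subp; rewrite in_setD => /andP[].
have nqphi w : phi w \notin q.
  apply/negP => wq; have [_] := qZ' _ wq.
  rewrite !inE negb_or => /andP[_]; rewrite imset_f // andbT negbK => E.
  move: unq => /= /andP[]; rewrite rcons_uniq mem_rcons inE negb_or.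
  move=> /andP[_ h1] /andP[h2 _].
  by case/orP: E => /eqP E; rewrite E in wq; rewrite wq in h1 h2.
have qZ x : x \in q -> x \notin Z.
  by move=> /qZ'[_]; rewrite inE negb_or => /andP[].
exists (fun b => if b == a then q else P b), (Z :|: [set x in q]); split.
- apply: leq_trans (leq_card_setU _ _) _.
  have : #|[set x in q]| <= size q by rewrite cardsE card_size.
  move: leZ sizeq sizep; clear; lia.
- by rewrite subUset sZY; apply/subsetP => x; rewrite inE => /qZ'[].
- by move=> w; rewrite !inE negb_or nphi nqphi.
- move=> b; rewrite inE; have [->|nba] := eqVneq b a; rewrite /= => bl Hb.
    split=> // [|x xq]; last by rewrite !inE xq orbT.
    by move: unq => /= /andP[_]; rewrite rcons_uniq => /andP[].
  have [? ? sub] := pathP _ bl Hb; split=> // x /sub xZ.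
  by rewrite inE xZ.
- move=> b c; rewrite !inE; have [->|nb] := eqVneq b a; have [->|nc] := eqVneq c a.
  + by [].
  + move=> _ /= cl _ Hc _ x /qZ; apply: contraNN.
    by have [_ _ sub] := pathP _ cl Hc => /sub.
  + move=> /= bl _ Hb _ _ x xP; have [_ _ /(_ _ xP)] := pathP _ bl Hb.
    by apply: contraTN => /qZ.
  + exact: dis.
Qed.

Lemma linked_hosts s Y X :
  irreflexive H -> linked T s Y X -> #|VH| <= #|X| -> copy_size <= s ->
  exists X1, [/\ X1 \subset Y, #|X1| <= copy_size & hosts setT X1].
Proof.
move=> irrH lk leX les.
pose phi u := enum_val (widen_ord leX (enum_rank u)).
have inj : injective phi.
  move=> u v /enum_val_inj E; apply/enum_rank_inj/val_inj.
  by have /= := congr1 val E.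
have inX u : phi u \in X by exact: enum_valP.
have sizeE : size (enum {: VH * VH}) = #|VH| * #|VH| by rewrite -cardE card_prod.
have [||P [Z [leZ sZY nphi pathP dis]]] :=
  @linked_arc_paths s Y X phi (enum {: VH * VH}) irrH lk inj inX.
- exact: enum_uniq.
- by rewrite sizeE; move: les; rewrite /copy_size; clear; lia.
exists (phi @: setT :|: Z); split.
- rewrite subUset sZY andbT; have [/subsetP sXY _] := lk.
  by apply/subsetP => _ /imsetP[u _ ->]; apply: sXY.
- apply: leq_trans (leq_card_setU _ _) _.
  by rewrite (card_imset _ inj) cardsT /copy_size leq_add2l -sizeE.
exists phi, (fun u v => P (u, v)); split.
- by move=> u v _ _; exact: inj.
- by move=> u _; rewrite inE imset_f.
- move=> u v /and3P[_ _ Huv].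
  have [pth un sub] := pathP (u, v) (mem_enum _ _) Huv; split=> //.
    by move=> x /sub xZ; rewrite inE xZ orbT.
  by move=> w _; apply: contraNN (nphi w) => /sub.
- move=> u v u' v' /and3P[_ _ Huv] /and3P[_ _ Huv'] neq.
  by apply: dis; rewrite ?mem_enum.
Qed.

(** Removing a copy costs at most [copy_size] vertices of [X] and lowers the linkage parameter by
    [copy_size], so [k] rounds are affordable. *)
Lemma linked_pack U k s Y X :
  irreflexive H -> linked T s Y X -> k * copy_size <= #|X| ->
  k * copy_size <= s -> pack U k Y.
Proof.
move=> irrH; elim: k s Y X => // k IH s Y X lk; rewrite mulSn => leX les.
have [||X1 [sX1 leX1 host]] := linked_hosts irrH lk.
- by apply: leq_trans leX; rewrite /copy_size; clear; lia.
- by move: les; clear; lia.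
exists X1, (Y :\: X1); split=> //; first exact: subsetDl.
- by rewrite disjoint_sym disjoints_subset subsetDr.
- by apply: hosts_restrict host; exact: subsetT.
apply: (IH (s - copy_size) _ (X :\: X1)).
- have [sXY link] := lk; split; first exact: setSD.
  move=> x y Z; rewrite !in_setD => /andP[nx xX] /andP[ny yX] nxy nxZ nyZ leZ.
  have [|||p [? ? sub ?]] := link x y (X1 :|: Z) xX yX nxy.
  + by rewrite inE negb_or nx.
  + by rewrite inE negb_or ny.
  + apply: leq_trans (leq_card_setU _ _) _; move: leX1 leZ les; clear; lia.
  + by exists p; split=> // t /sub; rewrite setDDl.
- have := cardsID X1 X; have := subset_leq_card (subsetIr X X1).
  by move: leX leX1; clear; lia.
- by move: les; clear; lia.
Qed.

(** The cover bound [28 * s + 10] at [s = k * copy_size], per unit of [k >= 1]. *)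
Definition cut_cost : nat := 28 * copy_size + 10.

Lemma degree_cut_no_arcs U k Y P :
  irreflexive H -> tournament T -> 0 < k -> ~ pack U k Y -> degree_cut T Y P ->
  exists Z, #|Z| <= cut_cost * k /\ no_arcs T ((Y :\: P) :\: Z) (P :\: Z).
Proof.
move=> irrH tourT k0 nopack cutP.
have [X0 lX0|Z [leZ noZ]] := degree_cut_cover tourT (s := k * copy_size) cutP.
  rewrite ltnNge; apply/negP => leX0; apply: nopack.
  exact: (@linked_pack U k (k * copy_size) Y X0 irrH lX0 leX0 (leqnn _)).
exists Z; split=> //; apply: leq_trans leZ _; rewrite /cut_cost; nia.
Qed.

End Models.

(** * Arithmetic of the bounding function *)

Lemma leq_ep_bound c c' k k' : c <= c' -> k <= k' -> ep_bound c k <= ep_bound c' k'.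
Proof.
move=> lec lek; rewrite /ep_bound !leq_mul // ltnS.
exact: leq_trunc_log.
Qed.

Lemma ep_boundD c c' k : ep_bound (c + c') k = ep_bound c k + ep_bound c' k.
Proof. by rewrite /ep_bound !mulnDl. Qed.

(** As [a < 2 ^ a], the factor [a] raises the logarithm by at most [a], which the factor [a.+1]
    absorbs. *)
Lemma ep_bound_scale c a k : 0 < k -> ep_bound c (a * k) <= ep_bound (c * a * a.+1) k.
Proof.
move=> k0; rewrite /ep_bound.
have [->|a0] := posnP a; first by rewrite mul0n muln0.
have le_log : trunc_log 2 (a * k) <= a + trunc_log 2 k.
  rewrite -ltnS -(ltn_exp2l _ _ (isT : 1 < 2)).
  apply: leq_ltn_trans (trunc_logP _ _) _; rewrite ?muln_gt0 ?a0 //.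
  rewrite -(addnS a) expnD; apply: ltn_mul; first exact: ltn_expl.
  exact: trunc_log_ltn.
move: (trunc_log _ _) le_log => l; move: (trunc_log _ _) => l' le.
apply: leq_trans (_ : c * (a * k) * (a + l').+1 <= _).
  by rewrite leq_mul2l ltnS le orbT.
have h : (a + l').+1 <= a.+1 * l'.+1 by clear; nia.
apply: leq_trans (leq_mul (leqnn _) h) _.
by rewrite !mulnA -(mulnA _ k) (mulnC k) !mulnA.
Qed.

(** Halving lowers the logarithm by one; this saving pays for the cut in the recursion. *)
Lemma ep_bound_halve c m q : q <= m./2 -> ep_bound c q <= c * q * trunc_log 2 m.
Proof.
move=> leq; rewrite /ep_bound; have [->|q0] := posnP q; first by rewrite muln0.
rewrite leq_mul2l; apply/orP; right.
by rewrite (@trunc_log2S m) ?ltnS ?leq_trunc_log //; move: leq q0; clear; lia.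
Qed.

(** * Hitting sets by recursion over cuts and over parts of [H] *)

Section ErdosPosa.
Variables (VH : finType) (H : rel VH).
Hypothesis irrH : irreflexive H.
Implicit Types (U W : {set VH}).

(** Relative to a vertex set [Y], so that both sides of a cut are again instances in the same
    tournament. *)
Definition erdos_posa c U : Prop :=
  forall (V : finType) (T : rel V), tournament T ->
  forall k (Y : {set V}), 0 < k -> ~ pack H T U k Y ->
  exists S : {set V}, #|S| <= ep_bound c k /\ ~ hosts H T U (Y :\: S).

Lemma hosts_setDS (V : finType) (T : rel V) U (X Y S S' : {set V}) :
  X \subset Y -> S' \subset S -> hosts H T U (X :\: S) -> hosts H T U (Y :\: S').
Proof. by move=> sXY sS; apply/hostsS/setDSS. Qed.

Lemma no_arcs_complete (V : finType) (T : rel V) (A B : {set V}) :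
  tournament T -> no_arcs T B A -> [disjoint A & B] ->
  forall x y, x \in A -> y \in B -> T x y.
Proof.
move=> tourT noBA dAB x y xA yB; apply: (tournament_total tourT); last exact: noBA.
by apply: contraTneq yB => ->; rewrite (disjointFr dAB xA).
Qed.

Lemma disjoint_cut (V : finType) (Y P Z : {set V}) :
  [disjoint P :\: Z & (Y :\: P) :\: Z].
Proof.
apply/pred0P => x /=; rewrite !inE.
by case: (x \in P); rewrite ?andbF.
Qed.

Lemma setD_cut_sub (V : finType) (Y P Z S : {set V}) :
  Z \subset S ->
  Y :\: S \subset (P :\: Z) :\: S :|: ((Y :\: P) :\: Z) :\: S.
Proof.
move=> sZS; apply/subsetP => x; rewrite !inE => /andP[nS ->].
by rewrite nS (contraNN (subsetP sZS x) nS); case: (x \in P).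
Qed.

Lemma setU1_cut_sub (V : finType) (v : V) (P Z S S' : {set V}) :
  v \in S -> S' \subset S -> ((v |: P) :\: Z) :\: S \subset P :\: S'.
Proof.
move=> vS sS'; apply/subsetP => x; rewrite !inE => /and3P[nS _ xP].
rewrite (contraNN (subsetP sS' x) nS) /=.
by case/orP: xP => // /eqP E; rewrite E vS in nS.
Qed.

(* When [H[U]] is strongly connected, no copy crosses a one-way cut, so a cut
   splitting the packing number evenly may be paid for recursively. *)
Lemma erdos_posa_strong U :
  U != set0 -> (forall W, down_closed H U W -> W = set0 \/ W = U) ->
  erdos_posa (2 * cut_cost VH + 1) U.
Proof.
move=> U0 strongU V T tourT; set c := 2 * cut_cost VH + 1.
(* With [m = k - 1] bounding the packing number, the bounds for the two sides of a cut, [q] and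
   [m - q - 1], sum to less than [m]. *)
suff main m (Y : {set V}) : ~ pack H T U m.+1 Y ->
    exists S : {set V}, #|S| <= ep_bound c m /\ ~ hosts H T U (Y :\: S).
  case=> // k Y _ /main[S [leS nh]]; exists S; split=> //.
  by apply: leq_trans leS (leq_ep_bound _ _).
elim/ltn_ind: m Y => m IH Y nopack.
have [m0|m0] := posnP m.
  exists set0; split; first by rewrite cards0.
  by rewrite setD0; move: nopack; rewrite m0 => np /pack1.
pose q := m./2.
have ltqm : q < m by rewrite /q; move: m0; clear; lia.
have [|noY|[P [v [vYP cutP noP packP]]]] :=
  @maximal_degree_cut _ T Y (fun P => ~ pack H T U q.+1 P).
- exact: pack_set0.
- have [S [leS nh]] := IH q ltqm Y noY; exists S; split=> //.
  by apply: leq_trans leS (leq_ep_bound _ (ltnW ltqm)).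
have {}packP := NNPP _ packP; set P1 := v |: P in cutP packP.
have [Z [leZ noZ]] := degree_cut_no_arcs irrH tourT (ltn0Sn m) nopack cutP.
(* [P1] already packs [q + 1] copies, so [m - q] more beyond it would give [m + 1] in [Y]. *)
have noB : ~ pack H T U (m - q.+1).+1 (Y :\: P1).
  move=> packB; apply: nopack.
  have E : m.+1 = q.+1 + (m - q.+1).+1 by move: ltqm; clear; lia.
  rewrite E; apply: packS (pack_add _ packP packB).
    rewrite subUset subsetDl andbT; exact: cutP.1.
  by rewrite disjoint_sym disjoints_subset subsetDr.
have [S1 [leS1 nh1]] := IH q ltqm P noP.
have ltb : m - q.+1 < m by move: m0; clear; lia.
have [S2 [leS2 nh2]] := IH _ ltb _ noB.
set S := Z :|: [set v] :|: S1 :|: S2.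
exists S; split.
  apply: leq_trans (leq_card_setU _ _) _.
  apply: leq_trans (leq_add (leq_card_setU _ _) (leqnn _)) _.
  apply: leq_trans (leq_add (leq_add (leq_card_setU _ _) (leqnn _)) (leqnn _)) _.
  have leb : m - q.+1 <= m./2 by rewrite /q; clear; lia.
  have := ep_bound_halve c leb; have := @ep_bound_halve c m q (leqnn _).
  move: leS1 leS2 leZ; rewrite cards1 => leS1 leS2 leZ le1 le2.
  apply: leq_trans (leq_add (leq_add (leq_add leZ (leqnn _)) (leq_trans leS1 le1)) (leq_trans leS2 le2)) _.
  rewrite /ep_bound -addnA -mulnDl -mulnDr (mulnSr (c * m)) [X in _ <= X]addnC.
  (* As [m >= 1], the cost [cut_cost VH * (m + 1) + 1] of [Z] and [v] is at most [c * m], the part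
     of the bound without logarithm. *)
  apply: leq_add; first by rewrite /c; move: m0; clear; nia.
  by rewrite leq_mul2r leq_mul2l; apply/orP; right; apply/orP; right; move: ltqm; clear; lia.
move=> host.
have sZ : Z \subset S by apply/subsetP => x; rewrite !inE => ->.
have vS : v \in S by rewrite !inE eqxx ?orbT.
have sS1 : S1 \subset S by apply/subsetP => x; rewrite !inE => ->; rewrite orbT.
have sS2 : S2 \subset S by apply/subsetP => x; rewrite !inE => ->; rewrite orbT.
pose A := P1 :\: Z; pose B := (Y :\: P1) :\: Z.
have : hosts H T U (A :\: S :|: B :\: S).
  by apply: hostsS host; exact: setD_cut_sub.
move=> /hosts_split[||W [clos hA hB]].
- by move=> x y /setDP[xB _] /setDP[yA _]; exact: noZ.
- apply: disjointWl (subsetDl _ _) _; apply: disjointWr (subsetDl _ _) _.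
  exact: disjoint_cut.
case: (strongU _ clos) => E.
  apply: nh2; rewrite E setD0 in hB; apply: hosts_setDS sS2 hB; exact: subsetDl.
apply: nh1; rewrite E in hA; by apply: hostsS hA; exact: setU1_cut_sub.
Qed.

(** For each splitting, [k] copies of [H[W]] in [A] and of the rest in [B] would join to [k] copies
    of [H[U]]. So one side packs fewer than [k], and the bound for smaller parts hits it there. *)
Lemma hit_straddling c U (V : finType) (T : rel V) k (A B : {set V})
    (l : seq {set VH}) :
  (forall W, W != set0 -> #|W| < #|U| -> erdos_posa c W) ->
  tournament T -> 0 < k -> no_arcs T B A -> [disjoint A & B] ->
  ~ pack H T U k (A :|: B) ->
  exists S : {set V}, #|S| <= size l * ep_bound c k /\
    forall W, W \in l -> down_closed H U W -> W != set0 -> W != U ->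
      ~ (hosts H T W (A :\: S) /\ hosts H T (U :\: W) (B :\: S)).
Proof.
move=> smaller tourT k0 noBA dAB nopack.
elim: l => [|W l [S [leS hitS]]]; first by exists set0; rewrite cards0.
case: (classic (down_closed H U W /\ W != set0 /\ W != U)) => [[clos [W0 WU]]|bad]; last first.
  exists S; split; first by rewrite /= mulSn; apply: leq_trans leS (leq_addl _ _).
  move=> W'; rewrite inE => /orP[/eqP->|]; last exact: hitS.
  by move=> h1 h2 h3; case: bad.
have prW : W \proper U by rewrite properEneq WU clos.1.
have [S' [leS' hitS']] : exists S' : {set V}, #|S'| <= ep_bound c k /\
    ~ (hosts H T W (A :\: S') /\ hosts H T (U :\: W) (B :\: S')).
  case: (classic (pack H T W k A)) => [packA|nopackA].
    have noB : ~ pack H T (U :\: W) k B.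
      by move=> packB; apply/nopack/(pack_join clos) => //; exact: no_arcs_complete.
    have [||S' [? nh]] := smaller (U :\: W) _ _ _ _ tourT _ _ k0 noB.
    - by rewrite setD_eq0; move: prW; rewrite properE => /andP[].
    - rewrite -(cardsID W U) (setIidPr clos.1) -{1}[#|_|]add0n ltn_add2r.
      by rewrite card_gt0.
    by exists S'; split=> // -[].
  have [S' [? nh]] := smaller W W0 (proper_card prW) _ _ tourT _ _ k0 nopackA.
  by exists S'; split=> // -[].
exists (S' :|: S); split.
  by apply: leq_trans (leq_card_setU _ _) _; rewrite /= mulSn leq_add.
have sub (X : {set V}) : X :\: (S' :|: S) \subset X :\: S by apply/setDS/subsetUr.
have sub' (X : {set V}) : X :\: (S' :|: S) \subset X :\: S' by apply/setDS/subsetUl.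
move=> W'; rewrite inE => /orP[/eqP->|W'l] cl W'0 W'U [hA hB].
  by apply: hitS'; split; [apply: hostsS hA | apply: hostsS hB].
by apply: (hitS W') => //; split; [apply: hostsS hA | apply: hostsS hB].
Qed.

(* A degree cut is placed where the prefix first packs many copies of [H[W]];
   then both sides pack few copies of a proper part of [H[U]], and hitting
   these parts together with the copies across the cut hits every [H[U]]. *)
Lemma erdos_posa_not_strong c U W :
  (forall W, W != set0 -> #|W| < #|U| -> erdos_posa c W) ->
  down_closed H U W -> W != set0 -> W != U ->
  erdos_posa ((cut_cost VH).+1 + c * (cut_cost VH).+1 * (cut_cost VH).+2
              + c + #|{set VH}| * c) U.
Proof.
move=> smaller clos W0 WU V T tourT k Y k0 nopack; set D := cut_cost VH.
have prW : W \proper U by rewrite properEneq WU clos.1.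
have epW := smaller W W0 (proper_card prW).
have UW0 : U :\: W != set0 by rewrite setD_eq0; move: prW; rewrite properE => /andP[].
have epUW : erdos_posa c (U :\: W).
  apply: smaller => //.
  rewrite -[X in _ < X](cardsID W U) (setIidPr clos.1) -{1}[#|_|]add0n ltn_add2r.
  by rewrite card_gt0.
have K0 : 0 < D.+1 * k by rewrite muln_gt0.
have bigK := ep_bound_scale c D.+1 k0.
(* The threshold [D.+1 * k] leaves [k] copies of [H[W]] in the prefix after deleting at most [D * k]
   vertices in [Z]. *)
have [|noY|[P [v [vYP cutP noP packP]]]] :=
  @maximal_degree_cut _ T Y (fun P => ~ pack H T W (D.+1 * k) P).
- exact: pack_set0.
- have [S [leS nh]] := epW _ _ tourT _ _ K0 noY; exists S; split.
    apply: leq_trans leS (leq_trans bigK _); apply: leq_ep_bound => //.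
    by rewrite -addnA addnAC leq_addl.
  by move=> /(hosts_restrict clos.1).
have {}packP := NNPP _ packP; set P1 := v |: P in cutP packP.
have [Z [leZ noZ]] := degree_cut_no_arcs irrH tourT k0 nopack cutP.
pose A := P1 :\: Z; pose B := (Y :\: P1) :\: Z.
have dAB : [disjoint A & B] by exact: disjoint_cut.
have packA : pack H T W k A by apply: (pack_setD leZ); rewrite -mulSn.
have noAB : ~ pack H T U k (A :|: B).
  apply: contra_not nopack; apply: packS.
  rewrite subUset !(subset_trans (subsetDl _ _)) // ?subsetDl //; exact: cutP.1.
have noB : ~ pack H T (U :\: W) k B.
  by move=> packB; apply/noAB/(pack_join clos) => //; exact: no_arcs_complete.
have [S1 [leS1 nh1]] := epW _ _ tourT _ _ K0 noP.
have [S2 [leS2 nh2]] := epUW _ _ tourT _ _ k0 noB.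
have [S3 [leS3 nh3]] :=
  hit_straddling (enum {: {set VH}}) smaller tourT k0 noZ dAB noAB.
set S := Z :|: [set v] :|: S1 :|: S2 :|: S3.
exists S; split.
  apply: leq_trans (leq_card_setU _ _) _.
  apply: leq_trans (leq_add (leq_card_setU _ _) (leqnn _)) _.
  apply: leq_trans (leq_add (leq_add (leq_card_setU _ _) (leqnn _)) (leqnn _)) _.
  apply: leq_trans (leq_add (leq_add (leq_add (leq_card_setU _ _) (leqnn _)) (leqnn _)) (leqnn _)) _.
  (* The four summands of the constant pay, in order, for [Z] with [v], for [S1], for [S2] and for
     [S3]. *)
  rewrite cards1 3!ep_boundD; apply: leq_add; last first.
    by move: leS3; rewrite -cardE /ep_bound !mulnA.
  apply: leq_add => //; apply: leq_add; last by apply: leq_trans leS1 bigK.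
  apply: leq_trans (leq_add leZ (leqnn 1)) _.
  apply: leq_trans (_ : D.+1 * k <= _); last exact: leq_pmulr.
  by rewrite mulSn addnC leq_add2r.
move=> host.
have sZ : Z \subset S by apply/subsetP => x; rewrite !inE => ->.
have vS : v \in S by rewrite !inE eqxx ?orbT.
have sS1 : S1 \subset S by apply/subsetP => x; rewrite !inE => ->; rewrite ?orbT.
have sS2 : S2 \subset S by apply/subsetP => x; rewrite !inE => ->; rewrite ?orbT.
have sS3 : S3 \subset S by apply/subsetP => x; rewrite !inE => ->; rewrite ?orbT.
have : hosts H T U (A :\: S :|: B :\: S).
  by apply: hostsS host; exact: setD_cut_sub.
move=> /hosts_split[||W' [clos' hA hB]].
- by move=> x y /setDP[xB _] /setDP[yA _]; exact: noZ.
- by apply: disjointWl (subsetDl _ _) _; apply: disjointWr (subsetDl _ _) _.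
(* A copy wholly in [B] contains one of [H[U :\: W]], hit by [S2]; one wholly in [A] contains one of
   [H[W]], hit by [v] or [S1]; the others straddle the cut and are hit by [S3]. *)
have [W'0|W'0] := eqVneq W' set0.
  apply: nh2; rewrite W'0 setD0 in hB; apply: hosts_restrict (subsetDl _ _) _.
  by apply: hosts_setDS sS2 hB.
have [W'U|W'U] := eqVneq W' U.
  apply: nh1; rewrite W'U in hA; apply: hosts_restrict clos.1 _.
  by apply: hostsS hA; exact: setU1_cut_sub.
apply: (nh3 W') => //; first by rewrite mem_enum.
by split; [apply: hosts_setDS sS3 hA | apply: hosts_setDS sS3 hB].
Qed.

Lemma erdos_posaW c c' U : c <= c' -> erdos_posa c U -> erdos_posa c' U.
Proof.
move=> lec ep V T tourT k Y k0 np; have [S [leS nh]] := ep V T tourT k Y k0 np.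
by exists S; split=> //; apply: leq_trans leS (leq_ep_bound lec _).
Qed.

(** One constant serves all parts of order below [n], as the non-strong case needs; adding the
    constants of both cases dominates each. *)
Lemma erdos_posa_bounded_order n :
  exists c, forall U, U != set0 -> #|U| < n -> erdos_posa c U.
Proof.
elim: n => [|n [c IH]]; first by exists 0.
pose D := cut_cost VH.
pose c2 := D.+1 + c * D.+1 * D.+2 + c + #|{set VH}| * c.
exists (2 * D + 1 + c2) => U U0; rewrite ltnS => leU.
case: (classic (exists W, [/\ down_closed H U W, W != set0 & W != U])).
  move=> [W [clos W0 WU]]; apply: (@erdos_posaW c2); first exact: leq_addl.
  apply: (erdos_posa_not_strong _ clos) => // W' W'0 ltW'.
  by apply: IH => //; apply: leq_trans leU.
move=> noW; apply: (@erdos_posaW (2 * D + 1)); first exact: leq_addr.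
apply: erdos_posa_strong => // W clos.
have [->|W0] := eqVneq W set0; first by left.
have [->|WU] := eqVneq W U; first by right.
by case: noW; exists W.
Qed.

(** * Translation to exact copies, and the conclusion *)

Lemma tm_copy_hosts (V : finType) (T : rel V) (X Y : {set V}) :
  tm_copy H T X -> X \subset Y -> hosts H T setT Y.
Proof.
move=> [phi [P [inj pathP dis ->]]] /subsetP sXY; exists phi, P; split.
- by move=> u v _ _; exact: inj.
- by move=> u _; apply: sXY; rewrite inE imset_f.
- move=> u v /and3P[_ _ Huv]; have [pth un nb] := pathP _ _ Huv; split=> //.
    move=> x xP; apply: sXY; rewrite !inE; apply/orP; right.
    by apply/existsP; exists u; apply/existsP; exists v; rewrite Huv.
  by move=> w _; apply/negP => /nb; rewrite codom_f.
- by move=> u v u' v' /and3P[_ _ Huv] /and3P[_ _ Huv']; exact: dis.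
Qed.

Lemma hosts_tm_copy (V : finType) (T : rel V) (Y : {set V}) :
  hosts H T setT Y -> exists2 X : {set V}, X \subset Y & tm_copy H T X.
Proof.
move=> [phi [P [inj inX pathP dis]]].
have arcT u v : H u v -> sub_arc H setT u v by rewrite /sub_arc !inE.
exists ([set phi w | w : VH] :|: [set x | [exists u, exists v, H u v && (x \in P u v)]]).
  apply/subsetP => x; rewrite !inE => /orP[/imsetP[u _ ->]|]; first exact: inX.
  by move=> /existsP[u /existsP[v /andP[/arcT /pathP[_ _ sub _] /sub]]].
exists phi, P; split=> //.
- by move=> u v; exact: inj.
- move=> u v /arcT /pathP[pth un _ nb]; split=> // x xP.
  by apply/negP => /codomP[w E]; have := nb w (in_setT _); rewrite -E xP.
- by move=> u v u' v' /arcT a /arcT b; exact: dis.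
Qed.

Lemma pack_tm_copies (V : finType) (T : rel V) k (Y : {set V}) :
  pack H T setT k Y ->
  exists Xs : 'I_k -> {set V},
    [/\ forall i, tm_copy H T (Xs i), forall i, Xs i \subset Y &
        forall i j, i != j -> [disjoint Xs i & Xs j]].
Proof.
elim: k Y => [|k IH] Y; first by move=> _; exists (fun=> set0); split=> -[].
move=> [X1 [X2 [s1 s2 d /hosts_tm_copy[X sX copyX] /IH[Xs [copies sub dis]]]]].
have dX i : [disjoint X & Xs i].
  by apply: disjointWl sX _; apply: disjointWr (sub i) _.
exists (fun i => if unlift ord0 i is Some j then Xs j else X); split.
- by move=> i; case: unliftP.
- move=> i; case: unliftP => [j _|_]; first exact: subset_trans (sub j) s2.
  exact: subset_trans sX s1.
- move=> i j; case: unliftP => [i' ->|->]; case: unliftP => [j' ->|->] //.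
  + by rewrite (inj_eq lift_inj); exact: dis.
  + by rewrite disjoint_sym.
Qed.

End ErdosPosa.

Theorem theorem6 (VH : finType) (H : rel VH) (simpleH : simple_digraph H) :
  exists c : nat,
    forall (k : nat) (V : finType) (T : rel V),
      0 < k -> tournament T ->
      (exists Xs : 'I_k -> {set V},
          (forall i, tm_copy H T (Xs i)) /\
          (forall i j, i != j -> [disjoint Xs i & Xs j]))
      \/
      (exists S : {set V},
          #|S| <= ep_bound c k /\
          (forall X : {set V}, tm_copy H T X -> ~~ [disjoint S & X])).
Proof.
have [c epc] := erdos_posa_bounded_order simpleH #|VH|.+1.
exists c => k V T k0 tourT.
(* For empty [H] the empty set is a copy disjoint from itself, so [k] disjoint copies always
   exist. *)
have [VH0|VH0] := eqVneq [set: VH] set0.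
  have noVH (w : VH) : False by have := in_setT w; rewrite VH0 inE.
  left; exists (fun=> set0); split=> [_|i j _]; last by rewrite -setI_eq0 setI0.
  exists (fun w => False_rect V (noVH w)), (fun _ _ => [::]).
  split=> [u|u|u|]; try by case: (noVH u).
  by apply/setP => x; rewrite !inE; apply/esym/negP => /orP[/imsetP[u]|/existsP[u]]; case: (noVH u).
case: (classic (pack H T setT k setT)) => [/pack_tm_copies[Xs [copies _ dis]]|nopack].
  by left; exists Xs.
have ltVH : #|[set: VH]| < #|VH|.+1 by rewrite cardsT.
right; have [S [leS nh]] := epc setT VH0 ltVH V T tourT k setT k0 nopack.
exists S; split=> // X copyX; apply/negP => dis; apply/nh/(tm_copy_hosts copyX).
by rewrite setTD -disjoints_subset disjoint_sym.
Qed.
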